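(* Under the standing assumptions in the context, almost surely on the event $\{\tau<\infty\}$, the process $(Y_{\tau+i}-Y_\tau)_{i\ge0}$, under either of the conditional laws $\mathbb P(\,\cdot\mid\tau,(Y_i)_{0\le i\le\tau})$ or $\mathbb P^{\angle}(\,\cdot\mid\tau,(Y_i)_{0\le i\le\tau})$, has the same distribution as $(Y_i)_{i\ge0}$ under $\mathbb P^{\angle}$.
   Context: Model: fix $q\in(0,1)$, $p_\circ,p_\bullet\in[0,1]$, $v_\circ=2p_\circ-1$, $v_\bullet=2p_\bullet-1$. Under $\mathbb P^\rho$: $\omega$ is a Poisson point process of intensity $\rho\sum_xP_x$ on the set $W$ of two-sided paths $w:\mathbb Z\to\mathbb Z$ with $|w(n+1)-w(n)|\le1$, where $P_x$ is the law of a two-sided lazy simple random walk (steps $-1,0,1$ with probabilities $\frac{1-q}2,q,\frac{1-q}2$) with $w(0)=x$; independently $(U_y)_{y\in\mathbb Z^2}$ are i.i.d. uniform $[0,1]$. $\mathcal T=\{(w(n),n): w\in\omega, n\in\mathbb Z\}$. For $y\in\mathbb Z^2$, $Y^y_0=y$, $Y^y_{i+1}=Y^y_i+(1,1)$ if ($Y^y_i\in\mathcal T$, $U_{Y^y_i}\le p_\bullet$) or ($Y^y_i\notin\mathcal T$, $U_{Y^y_i}\le p_\circ$), else $Y^y_{i+1}=Y^y_i+(-1,1)$; $X^y$ is its spatial coordinate; $Y=Y^{(0,0)}$, $X=X^{(0,0)}$. Standing assumptions: $v_\bullet>0$, $v_\circ>-1$, $\rho\in(0,\infty)$, and for some $v_\star\in(0,v_\bullet)$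 there are $c_0>0,\gamma>1$ with $\mathbb P^\rho(\exists n\in\mathbb N: X_n<nv_\star-L)\le c_0^{-1}e^{-c_0\log^\gamma L}$ for all $L\in\mathbb N$. Write $\mathbb P=\mathbb P^\rho$, $\bar v=v_\star/3$. Cones: $\angle(x,n)=(x,n)+\{(x',n')\in\mathbb Z_+^2: x'\ge\bar vn'\}$ and $\angle^{\mathrm{rev}}(x,n)=(x,n)+\{(x',n')\in\mathbb Z_-^2: x'<\bar vn'\}$ ($\mathbb Z_\pm$ include $0$). The trace of $w\in W$ is $\{(w(n),n):n\in\mathbb Z\}$. $W^{\times}_y$ is the set of $w$ whose trace intersects both $\angle(y)$ and $\angle^{\mathrm{rev}}(y)$. $A^y=\{Y^y_i\in\angle(y)\ \forall i\ge0\}$. Record times: $R_k=\inf\{n\ge0: X_n\ge(1-\bar v)k+\bar vn\}$, $k\in\mathbb N$. $\mathbb P^{\angle}(\cdot)=\mathbb P(\,\cdot\mid \omega(W^\times_{(0,0)})=0,\ A^{(0,0)})$. Regeneration index $\mathcal I=\inf\{k\in\mathbb N: \omega(W^\times_{Y_{R_k}})=0\text{ and }A^{Y_{R_k}}\text{ occurs}\}$ and regeneration time $\tau=R_{\mathcal I}$. *)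

(* Defs.v *)
From HB Require Import structures.
From mathcomp Require Import all_boot all_order all_algebra.
From mathcomp Require Import all_classical all_reals all_analysis measurable_realfun.
Set Implicit Arguments. Unset Strict Implicit. Unset Printing Implicit Defensive.
Import Order.TTheory GRing.Theory Num.Theory.
Local Open Scope classical_set_scope.
Local Open Scope ring_scope.

HB.instance Definition _ := isPointed.Build int 0%R.

(* Space-time points are pairs (x, n) : int * int, x = spatial, n = time. *)

Definition coord_sets : set (set (int -> int)) :=
  [set A | exists (n x : int), A = [set w | w n = x]].
Definition Wm := g_sigma_algebraType coord_sets.

Definition lazy_step {R : realType} (q : R) (d : int) : R :=
  if d == 0 then q else if (d == 1) || (d == -1) then (1 - q) / 2 else 0.

(* Px x is the law of the two-sided lazy SRW with w(0) = x: its finite-dimensional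
   distributions on windows [-m, n] (which determine it). *)
Definition lazy_walk_laws {R : realType} (q : R)
    (Px : int -> {measure set Wm -> \bar R}) : Prop :=
  forall (x : int) (m n : nat) (y : int -> int),
    Px x [set w : Wm | forall i : int, (- (m%:Z) <= i <= n%:Z) -> w i = y i] =
    (if y 0 == x then
       \prod_(i < m + n) lazy_step q (y (i%:Z - m%:Z + 1) - y (i%:Z - m%:Z))
     else 0)%:E.

Definition intensity {R : realType} (rho : R)
    (Px : int -> {measure set Wm -> \bar R}) (A : set Wm) : \bar R :=
  (rho%:E * \esum_(x in [set: int]) Px x A)%E.

(* a point configuration on W is given by its multiplicity function;
   omega(A) = number of points (with multiplicity) in A *)
Definition cnt {R : realType} (om : Wm -> nat) (A : set Wm) : \bar R :=
  \esum_(w in A) ((om w)%:R : R)%:E.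

Definition poisson_p {R : realType} (r : R) (k : nat) : R :=
  r ^+ k / (k`!)%:R * expR (- r).

(* omega is a Poisson point process with intensity mu, U = (U_y) are i.i.d.
   uniform on [0,1], and omega, U are independent: joint law on the
   generating pi-system (counts of disjoint finite-intensity sets,
   values of finitely many distinct U_y's). *)
Definition ppp_unif_law {R : realType} {d : measure_display} {Om : measurableType d}
    (P : probability Om R) (om : Om -> Wm -> nat) (U : Om -> int * int -> R)
    (mu : set Wm -> \bar R) : Prop :=
  forall (k m : nat) (A : 'I_k -> set Wm) (cn : 'I_k -> nat)
         (ys : 'I_m -> int * int) (a : 'I_m -> R),
    (forall i, measurable (A i)) ->
    (forall i j, i != j -> A i `&` A j = set0) ->
    (forall i, (mu (A i) < +oo)%E) ->
    injective ys ->
    (forall j, 0 <= a j <= 1) ->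
    P [set t | (forall i, cnt (om t) (A i) = ((cn i)%:R : R)%:E) /\
               (forall j, U t (ys j) <= a j)] =
    ((\prod_i poisson_p (fine (mu (A i))) (cn i)) * \prod_j a j)%:E.

Definition trace (om : Wm -> nat) : set (int * int) :=
  [set z | exists w : Wm, (0 < om w)%N /\ w z.2 = z.1].

Definition step {R : realType} (pb po : R) (Tr : set (int * int))
    (U : int * int -> R) (z : int * int) : int * int :=
  if `[< (Tr z /\ U z <= pb) \/ (~ Tr z /\ U z <= po) >]
  then (z.1 + 1, z.2 + 1) else (z.1 - 1, z.2 + 1).

Definition Ypath {R : realType} (pb po : R) (Tr : set (int * int))
    (U : int * int -> R) (y : int * int) (i : nat) : int * int :=
  iter i (step pb po Tr U) y.

Definition in_cone {R : realType} (vbar : R) (y z : int * int) : Prop :=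
  (y.1 <= z.1) /\ (y.2 <= z.2) /\ vbar * (z.2 - y.2)%:~R <= (z.1 - y.1)%:~R.
Definition in_rcone {R : realType} (vbar : R) (y z : int * int) : Prop :=
  (z.1 <= y.1) /\ (z.2 <= y.2) /\ (z.1 - y.1)%:~R < vbar * (z.2 - y.2)%:~R.

Definition Wcross {R : realType} (vbar : R) (y : int * int) : set Wm :=
  [set w | (exists n : int, in_cone vbar y (w n, n)) /\
           (exists n : int, in_rcone vbar y (w n, n))].

Definition Aev {R : realType} (vbar pb po : R) (Tr : set (int * int))
    (U : int * int -> R) (y : int * int) : Prop :=
  forall i, in_cone vbar y (Ypath pb po Tr U y i).

Definition good {R : realType} (vbar pb po : R) (om : Wm -> nat)
    (U : int * int -> R) (y : int * int) : Prop :=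
  cnt (R := R) om (Wcross vbar y) = 0%E /\ Aev vbar pb po (trace om) U y.

Definition isR {R : realType} (vbar : R) (X : nat -> int) (k n : nat) : Prop :=
  (1 - vbar) * k%:R + vbar * n%:R <= (X n)%:~R /\
  forall m, (m < n)%N -> (X m)%:~R < (1 - vbar) * k%:R + vbar * m%:R.

Definition tau_is {R : realType} (vbar pb po : R) (om : Wm -> nat)
    (U : int * int -> R) (n : nat) : Prop :=
  let Y := Ypath pb po (trace om) U (0, 0) in
  let X := fun i => (Y i).1 in
  exists k : nat, (1 <= k)%N /\ isR vbar X k n /\ good vbar pb po om U (Y n) /\
    forall j m : nat, (1 <= j < k)%N -> isR vbar X j m ->
      ~ good vbar pb po om U (Y m).

Definition condP {R : realType} {d : measure_display} {Om : measurableType d}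
    (P : probability Om R) (C E : set Om) : R :=
  fine (P (E `&` C)) / fine (P C).

(* Main.v *)
(** Fix y = Y_n and split the environment into the walks hitting the cone of y together
    with the uniform variables inside it, and the rest; by the Poisson property the two
    parts are independent.  If no walk crosses from the reverse cone to the cone and the
    path stays in the cone, then everything after time n is a function of the first part.
    The record property puts Y_0, ..., Y_(n-1) in the reverse cone of y, which on that
    event only walks of the second part visit; moreover for an earlier record z with y in
    its cone, the reverse cone of z lies in that of y, so whether z was a regeneration
    point is a function of the second part too.  Hence the law of the future given the past
    is that of the walk from y conditioned on y being good, and translation invariance of
    the Poisson intensity moves y to the origin. *)
Require Import Defs.
From HB Require Import structures.
From mathcomp Require Import all_boot all_order all_algebra.
From mathcomp Require Import all_classical all_reals all_analysis measurable_realfun.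
From mathcomp Require Import zify ring lra.
Import Order.TTheory GRing.Theory Num.Theory.
Local Open Scope classical_set_scope.
Local Open Scope ring_scope.

(** * Measurability of events written as formulas *)

Lemma measurable_forall {d} {T : measurableType d} {I : countType}
    (Q : I -> T -> Prop) :
  (forall i, measurable [set t | Q i t]) -> measurable [set t | forall i, Q i t].
Proof.
move=> mQ; rewrite (_ : [set t | forall i, Q i t] = ~` \bigcup_i ~` [set t | Q i t]).
  apply: measurableC; apply: countable_bigcupT_measurable; first exact: countableP.
  by move=> i; exact: measurableC.
apply/seteqP; split=> t /= h; first by case=> i _; exact.
by move=> i; apply: contrapT => nQ; apply: h; exists i.
Qed.

Lemma measurable_not {d} {T : measurableType d} (Q : T -> Prop) :
  measurable [set t | Q t] -> measurable [set t | ~ Q t].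
Proof. exact: measurableC. Qed.

Lemma measurable_exists {d} {T : measurableType d} {I : countType}
    (Q : I -> T -> Prop) :
  (forall i, measurable [set t | Q i t]) -> measurable [set t | exists i, Q i t].
Proof.
move=> mQ; rewrite (_ : [set t | exists i, Q i t] = \bigcup_i [set t | Q i t]).
  by apply: countable_bigcupT_measurable => //; exact: countableP.
by apply/seteqP; split=> t /= [i] => [h|_ h]; exists i.
Qed.

Lemma measurable_and {d} {T : measurableType d} (Q1 Q2 : T -> Prop) :
  measurable [set t | Q1 t] -> measurable [set t | Q2 t] ->
  measurable [set t | Q1 t /\ Q2 t].
Proof. exact: measurableI. Qed.

Lemma measurable_or {d} {T : measurableType d} (Q1 Q2 : T -> Prop) :
  measurable [set t | Q1 t] -> measurable [set t | Q2 t] ->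
  measurable [set t | Q1 t \/ Q2 t].
Proof. exact: measurableU. Qed.

Lemma measurable_imp {d} {T : measurableType d} (Q1 : Prop) (Q2 : T -> Prop) :
  (Q1 -> measurable [set t | Q2 t]) -> measurable [set t | Q1 -> Q2 t].
Proof.
move=> m; have [q|nq] := pselect Q1.
  rewrite (_ : [set t | Q1 -> Q2 t] = [set t | Q2 t]); first exact: m.
  by apply/seteqP; split => t /=; [exact|].
rewrite (_ : [set t | Q1 -> Q2 t] = setT) //.
by apply/seteqP; split => t //= _ /nq.
Qed.

Lemma measurable_const {d} {T : measurableType d} (Q : Prop) :
  measurable [set t : T | Q].
Proof.
have [q|nq] := pselect Q.
  by rewrite (_ : [set _ | Q] = setT) //; apply/seteqP; split => t.
by rewrite (_ : [set _ | Q] = set0) //; apply/seteqP; split => t.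
Qed.

(** * The intensity as a measure on walks *)

Lemma esum_exchange {R : realType} {T1 T2 : choiceType} (a : T1 -> T2 -> \bar R) :
  (forall i j, 0 <= a i j)%E ->
  (\esum_(i in [set: T1]) \esum_(j in [set: T2]) a i j =
   \esum_(j in [set: T2]) \esum_(i in [set: T1]) a i j)%E.
Proof.
move=> a0; rewrite !esum_esum//.
rewrite (@reindex_esum _ _ _ ([set: T2] `*`` fun=> [set: T1]) _ (fun k => (k.2, k.1))) //.
split.
- by move=> [x y].
- by move=> [x y] [x' y'] _ _ /= [-> ->].
- by move=> [x y] _; exists (y, x).
Qed.

Section intensity_measure.
Context {R : realType} (rho : R) (Px : int -> {measure set Wm -> \bar R}).
Hypothesis rho0 : 0 < rho.
Let mu : set Wm -> \bar R := intensity rho Px.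
Local Open Scope ereal_scope.

Let mu0 : mu set0 = 0.
Proof. by rewrite /mu /intensity esum1 ?mule0// => i _; rewrite measure0. Qed.

Let mu_ge0 A : 0 <= mu A.
Proof. by apply: mule_ge0; [rewrite lee_fin ltW|apply: esum_ge0]. Qed.

Let mu_semi_sigma_additive : semi_sigma_additive mu.
Proof.
move=> F mF tF mUF.
have -> : mu (\bigcup_n F n) = \sum_(i <oo) mu (F i).
  rewrite nneseries_esumT// /mu /intensity.
  transitivity (\esum_(x in [set: nat]) (rho%:E * \esum_(y in [set: int]) Px y (F x))).
    rewrite -nneseries_esumT; last by move=> n; exact: mu_ge0.
    rewrite nneseriesZl; last by move=> i _; exact: esum_ge0.
    congr (_ * _); rewrite nneseries_esumT; last by move=> n; exact: esum_ge0.
    rewrite esum_exchange//; apply: eq_esum => x _.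
    by rewrite measure_semi_bigcup// nneseries_esumT.
  by [].
by apply: is_cvg_ereal_nneg_natsum => k _; exact: mu_ge0.
Qed.

HB.instance Definition _ :=
  isMeasure.Build _ Wm R mu mu0 mu_ge0 mu_semi_sigma_additive.

Definition intensity_measure : {measure set Wm -> \bar R} := mu.

End intensity_measure.

(** * Cylinders and translation invariance of the intensity *)

Lemma measurable_coord (n x : int) : measurable [set w : Wm | w n = x].
Proof. by apply: sub_sigma_algebra; exists n, x. Qed.

Lemma measurable_coord_pred (n : int) (Q : int -> Prop) :
  measurable [set w : Wm | Q (w n)].
Proof.
rewrite (_ : [set w : Wm | _] = [set w | exists x : int, Q x /\ w n = x]).
  apply: measurable_exists => x; apply: measurable_and; first exact: measurable_const.
  exact: measurable_coord.
by apply/seteqP; split => w /= => [h|[x [h ->]]//]; exists (w n).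
Qed.

Definition cyl (m n : nat) (y : int -> int) : set Wm :=
  [set w : Wm | forall i : int, (- (m%:Z) <= i <= n%:Z) -> w i = y i].

Lemma measurable_cyl m n y : measurable (cyl m n y).
Proof.
apply: measurable_forall => i; apply: measurable_imp => _.
exact: measurable_coord.
Qed.

(* Only windows containing [-N, N] are kept, so that a time shift by at most N turns
   each cylinder into one whose window still contains the origin. *)
Definition cyls (N : nat) : set (set Wm) :=
  [set A | A = set0 \/ exists m n y, [/\ (N <= m)%N, (N <= n)%N & A = cyl m n y]].

Lemma cyls_setI N : setI_closed (cyls N).
Proof.
move=> A B [->|[m [n [y [Nm Nn ->]]]]]; first by left; rewrite set0I.
move=> [->|[m' [n' [y' [Nm' Nn' ->]]]]]; first by left; rewrite setI0.
have [[w [wA wB]]|no] := pselect (exists w, (cyl m n y `&` cyl m' n' y') w); last first.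
  by left; apply/seteqP; split => // w h; apply: no; exists w.
right; exists (maxn m m'), (maxn n n'), w; split; [lia|lia|].
apply/seteqP; split => v /=.
  move=> [vA vB] i hi.
  have [h|h] : (- (m%:Z) <= i <= n%:Z) \/ (- (m'%:Z) <= i <= n'%:Z) by lia.
    by rewrite vA// wA.
  by rewrite vB// wB.
by move=> h; split=> i hi; rewrite h; [exact: wA|lia|exact: wB|lia].
Qed.

(** Codes a path on the window [[-M, M]] by a finite sequence, entry [k] being the value at time
    [k - M]. Finite integer sequences are countable, hence so are the windows seen; values outside
    the window do not matter. *)
Definition seq_path (M : nat) (s : seq int) : int -> int :=
  fun i => nth 0 s (absz (i + M%:Z)).

Lemma seq_path_surj (M : nat) (w : Wm) :
  cyl M M (seq_path M (mkseq (fun k => w (k%:Z - M%:Z)) (M + M).+1)) w.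
Proof.
move=> i hi; rewrite /seq_path nth_mkseq; last lia.
by congr w; lia.
Qed.

(** A coordinate event is the union of the window cylinders compatible with it, and this union is
    countable because windows are coded by sequences. *)
Lemma cyls_generate N : @measurable _ Wm = <<s cyls N >>.
Proof.
apply/seteqP; split.
  apply: smallest_sub; first exact: smallest_sigma_algebra.
  move=> _ [n [x ->]].
  pose T : measurableType _ := g_sigma_algebraType (cyls N).
  pose M := (N + absz n)%N.
  change (measurable ([set w | w n = x] : set T)).
  rewrite (_ : [set w | _] = [set w : T | exists s : seq int,
      seq_path M s n = x /\ cyl M M (seq_path M s) w]).
    apply: measurable_exists => s; apply: measurable_and; first exact: measurable_const.
    apply: sub_sigma_algebra; right; exists M, M, (seq_path M s).
    by split => //; rewrite /M; lia.
  apply/seteqP; split => w /=.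
    move=> wx; exists (mkseq (fun k => w (k%:Z - M%:Z)) (M + M).+1); split.
      by rewrite -wx; apply/esym/seq_path_surj; rewrite /M; lia.
    exact: seq_path_surj.
  by move=> [s [<-]]; apply; rewrite /M; lia.
apply: smallest_sub; first exact: sigma_algebra_measurable.
move=> A [->//|[m [n [y [_ _ ->]]]]]; exact: measurable_cyl.
Qed.

(** Translates the space-time trace by the vector [(x0, s)]. *)
Definition wshift (s x0 : int) (w : Wm) : Wm := fun n => w (n - s) + x0.

Lemma measurable_wshift s x0 : measurable_fun [set: Wm] (wshift s x0).
Proof.
apply: (@measurability _ _ _ _ setT (wshift s x0) coord_sets) => //.
move=> _ [_ [n [x ->]] <-]; rewrite setTI.
rewrite (_ : _ @^-1` _ = [set w : Wm | w (n - s) = x - x0]).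
  exact: measurable_coord.
by apply/seteqP; split => w; rewrite /wshift /=; lia.
Qed.

Section intensity_law.
Context {R : realType} (q rho : R) (Px : int -> {measure set Wm -> \bar R}).
Hypothesis rho0 : 0 < rho.
Hypothesis law : lazy_walk_laws q Px.
Let mu := intensity_measure rho Px rho0.

(** Only the starting point [x = y 0] contributes to the sum. The result depends on the increments
    and not on where the origin sits in the window, which is the source of translation
    invariance. *)
Lemma intensity_cyl (m n : nat) (y : int -> int) :
  mu (cyl m n y) =
  (rho * \prod_(i < m + n) lazy_step q (y (i%:Z - m%:Z + 1) - y (i%:Z - m%:Z)))%:E.
Proof.
rewrite /mu /intensity_measure /= /intensity EFinM; congr (_ * _)%E.
rewrite (esumID [set y 0]); last first.
  by move=> i _; exact: measure_ge0.
rewrite !setTI esum_set1//.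
rewrite [X in (_ + X)%E]esum1 ?adde0; last first.
  by move=> x /= /eqP; rewrite eq_sym => /negbTE xy; rewrite law xy.
by rewrite law eqxx.
Qed.

(** Both sides are measures in [A]. They agree on cylinders whose window contains [[-N, N]], since a
    shift preserves increments, and these cylinders form a generating pi-system. *)
Lemma intensity_shift (s x0 : int) (A : set Wm) : measurable A ->
  mu (wshift s x0 @^-1` A) = mu A.
Proof.
move=> mA; pose N := absz s.
(* A countable cover by cylinders of finite intensity, as uniqueness is applied to sigma-finite
   measures. *)
pose g k : set Wm :=
  if unpickle k is Some l then cyl N N (seq_path N l) else set0.
have sm := measurable_wshift s x0.
change (pushforward mu (wshift s x0) A = mu A); apply/esym.
apply: (@g_sigma_algebra_measure_unique _ R Wm (cyls N) _ g _ _
  mu (pushforward mu (wshift s x0))) => //.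
- by rewrite (cyls_generate N); exact: sub_sigma_algebra.
- move=> k; rewrite /g; case: unpickle => [l|]; last by left.
  by right; exists N, N, (seq_path N l).
- apply/seteqP; split => // w _.
  exists (pickle (mkseq (fun k => w (k%:Z - N%:Z)) (N + N).+1)) => //.
  by rewrite /g pickleK; exact: seq_path_surj.
- exact: cyls_setI.
- move=> _ [->|[m [n [y [Nm Nn ->]]]]]; first by rewrite !measure0.
  change (mu (cyl m n y) = mu (wshift s x0 @^-1` cyl m n y)).
  (* Shifting the window [[-m, n]] back by [s] gives [[-m - s, n - s]]; both [m + s] and [n - s] are
     nonnegative because [m] and [n] are at least [N = |s|]. *)
  pose m' := absz (m%:Z + s); pose n' := absz (n%:Z - s).
  rewrite (_ : _ @^-1` _ = cyl m' n' (fun j => y (j + s) - x0)); last first.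
    apply/seteqP; split => w h i hi.
      have := h (i + s); rewrite /wshift addrK => <-; first by rewrite addrK.
      rewrite /m' /n' /N in hi Nm Nn *; lia.
    rewrite /wshift h ?subrK//.
    rewrite /m' /n' /N in hi Nm Nn *; lia.
  rewrite !intensity_cyl; congr (_ * _)%:E.
  have e : (m' + n' = m + n)%N by rewrite /m' /n' /N in Nm Nn *; lia.
  rewrite e; apply: eq_bigr => i _.
  congr (lazy_step q _).
  have -> : i%:Z - m'%:Z + 1 + s = i%:Z - m%:Z + 1.
    rewrite /m' /N in Nm *; lia.
  have -> : i%:Z - m'%:Z + s = i%:Z - m%:Z.
    rewrite /m' /N in Nm *; lia.
  by ring.
- move=> k; rewrite /g; case: unpickle => [l|]; last by rewrite measure0 ltry.
  by rewrite intensity_cyl ltry.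
- by move: mA; rewrite (cyls_generate N).
Qed.

(** A shift moves [(x, n)] to the origin, where the window has one point and the product of step
    probabilities is empty. *)
Lemma intensity_coord (n x : int) : mu [set w : Wm | w n = x] = rho%:E.
Proof.
rewrite (_ : [set w | _] = wshift (- n) (- x) @^-1` (cyl 0 0 (fun=> 0))).
  rewrite intensity_shift; last exact: measurable_cyl.
  by rewrite intensity_cyl big_ord0 mulr1.
apply/seteqP; split => w /=; rewrite /wshift.
  by move=> h i hi; rewrite (_ : i - - n = n); [lia|lia].
by move=> /(_ 0 isT); rewrite (_ : 0 - - n = n); lia.
Qed.

End intensity_law.

(** * Configurations and void events *)

Lemma cnt0P {R : realType} (om : Wm -> nat) (A : set Wm) :
  cnt (R := R) om A = 0%E <-> forall w, A w -> om w = 0%N.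
Proof.
split=> [h w Aw|h]; last by apply: esum1 => w Aw; rewrite h.
suff : (((om w)%:R : R)%:E <= 0)%E by rewrite lee_fin lern0 => /eqP.
rewrite -h; apply: esum_ge; exists [set w]; last by rewrite fsbig_set1.
by split; [exact: finite_set1|move=> _ ->].
Qed.

(** The Poisson law for a single set and count zero. Duplicates in [s] are removed because the law
    speaks of distinct sites. *)
Lemma ppp_void {R : realType} {d : measure_display} {Om : measurableType d}
    (P : probability Om R) (om : Om -> Wm -> nat) (U : Om -> int * int -> R)
    (mu : set Wm -> \bar R) (A : set Wm) (s : seq (int * int)) (a : int * int -> R) :
  ppp_unif_law P om U mu -> measurable A -> (mu A < +oo)%E ->
  (forall z, 0 <= a z <= 1) ->
  P [set t | (forall w, A w -> om t w = 0%N) /\ forall z, z \in s -> U t z <= a z] =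
  (expR (- fine (mu A)) * \prod_(z <- undup s) a z)%:E.
Proof.
move=> law mA Aoo a01.
have := law 1%N (size (undup s)) (fun=> A) (fun=> 0%N)
  (fun j => tnth (in_tuple (undup s)) j) (fun j => a (tnth (in_tuple (undup s)) j)).
rewrite big_ord_recl big_ord0 mulr1 /poisson_p expr0 fact0 divr1 mul1r.
rewrite -(big_tnth _ _ (undup s) xpredT a) => <- //.
- congr (P _); apply/seteqP; split => t /= [h1 h2]; split.
  + by move=> _; apply/cnt0P.
  + by move=> j; apply: h2; rewrite -mem_undup mem_tnth.
  + by apply/(@cnt0P R); exact: (h1 ord0).
  + move=> z; rewrite -mem_undup => /(nthP (0, 0))[i si <-].
    by have := h2 (Ordinal si); rewrite (tnth_nth (0, 0)).
- by move=> i j; rewrite !ord1 eqxx.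
- move=> i j; rewrite !(tnth_nth (0, 0)) => /eqP.
  by rewrite nth_uniq ?undup_uniq// => /eqP/val_inj.
Qed.

Definition cfg (R : realType) : Type := ((Wm -> nat) * (int * int -> R))%type.
HB.instance Definition _ (R : realType) := gen_eqMixin (cfg R).
HB.instance Definition _ (R : realType) := gen_choiceMixin (cfg R).
HB.instance Definition _ (R : realType) :=
  isPointed.Build (cfg R) (fun=> 0%N, fun=> 0).

(* The path depends on the point process only through the emptiness of sets of walks,
   so void probabilities determine all the laws needed. *)
Definition void_event {R : realType} (A : set Wm) (s : seq (int * int))
    (a : int * int -> R) : set (cfg R) :=
  [set c | (forall w, A w -> c.1 w = 0%N) /\ forall z, z \in s -> c.2 z <= a z].

Definition void_events {R : realType} (mu : {measure set Wm -> \bar R}) :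
    set (set (cfg R)) :=
  [set E | exists A s a, [/\ measurable A, (mu A < +oo)%E,
    forall z, 0 <= a z <= 1 & E = void_event A s a]].

Notation cfgm mu := (g_sigma_algebraType (void_events mu)).

(** The environment seen from [z0]: the new origin is the old site [z0]. *)
Definition cshift {R : realType} (z0 : int * int) (c : cfg R) : cfg R :=
  (fun w => c.1 (wshift z0.2 z0.1 w), fun z => c.2 (z.1 + z0.1, z.2 + z0.2)).

(** The default value 0 of the uniforms meets every nonnegative threshold, so pulling a void event
    back along a restriction only drops constraints. *)
Definition crestr {R : realType} (B : set Wm) (D : set (int * int)) (c : cfg R) :
    cfg R :=
  (fun w => if `[< B w >] then c.1 w else 0%N,
   fun z => if `[< D z >] then c.2 z else 0).

Lemma wshiftK (s x0 : int) : cancel (wshift s x0) (wshift (- s) (- x0)).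
Proof. by move=> w; apply/funext => n; rewrite /wshift addrK opprK addrK. Qed.

Lemma wshiftVK (s x0 : int) : cancel (wshift (- s) (- x0)) (wshift s x0).
Proof. by move=> w; apply/funext => n; rewrite /wshift opprK !subrK. Qed.

Lemma cshift_void {R : realType} z0 A s (a : _ -> R) :
  cshift z0 @^-1` void_event A s a =
  void_event (wshift (- z0.2) (- z0.1) @^-1` A)
    [seq (z.1 + z0.1, z.2 + z0.2) | z <- s] (fun z => a (z.1 - z0.1, z.2 - z0.2)).
Proof.
apply/seteqP; split => c [h1 h2]; split => /=.
- by move=> w /h1 /=; rewrite wshiftVK.
- by move=> _ /mapP[z zs ->] /=; rewrite !addrK -surjective_pairing; exact: h2.
- by move=> w Aw; apply: h1 => /=; rewrite wshiftK.
- move=> z zs; have := h2 (z.1 + z0.1, z.2 + z0.2).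
  by rewrite /= !addrK -surjective_pairing; apply; apply/mapP; exists z.
Qed.

Lemma crestr_void {R : realType} B D A s (a : _ -> R) : (forall z, 0 <= a z) ->
  crestr B D @^-1` void_event A s a =
  void_event (A `&` B) [seq z <- s | `[< D z >]] a.
Proof.
move=> a0; apply/seteqP; split => c [h1 h2]; split => /=.
- by move=> w [/h1 /=] + /asboolP Bw; rewrite Bw.
- by move=> z; rewrite mem_filter => /andP[Dz /h2 /=]; rewrite Dz.
- by move=> w Aw; case: asboolP => // Bw; exact: h1.
- by move=> z zs; case: ifP => // Dz; apply: h2; rewrite mem_filter Dz.
Qed.

(** * Uniqueness, stationarity and independence for the law on configurations *)

Section canonical_law.
Context {R : realType} (mu : {measure set Wm -> \bar R}).
Local Notation cfgm := (cfgm mu).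

(* Thresholds are at most 1, so 1 marks the absence of a constraint. *)
Definition merge_thr (s1 s2 : seq (int * int)) (a1 a2 : int * int -> R) z : R :=
  Num.min (if z \in s1 then a1 z else 1) (if z \in s2 then a2 z else 1).

Lemma void_eventI A1 A2 s1 s2 (a1 a2 : int * int -> R) :
  (forall z, a1 z <= 1) -> (forall z, a2 z <= 1) ->
  void_event A1 s1 a1 `&` void_event A2 s2 a2 =
  void_event (A1 `|` A2) (s1 ++ s2) (merge_thr s1 s2 a1 a2).
Proof.
move=> a11 a21; apply/seteqP; split => c.
  move=> [[h1 h2] [h3 h4]]; split; first by move=> w [/h1|/h3].
  move=> z; rewrite mem_cat /merge_thr le_min.
  case: ifPn => [/h2 e1|_]; case: ifPn => [/h4 e2|_] //= _; apply/andP; split => //.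
  - exact: le_trans e1 _.
  - exact: le_trans e2 _.
move=> [h1 h2]; split; split.
- by move=> w Aw; apply: h1; left.
- by move=> z zs; have := h2 z; rewrite mem_cat zs /merge_thr zs le_min => /(_ isT)/andP[].
- by move=> w Aw; apply: h1; right.
- by move=> z zs; have := h2 z; rewrite mem_cat zs orbT /merge_thr zs le_min => /(_ isT)/andP[].
Qed.

Lemma merge_thr01 s1 s2 (a1 a2 : int * int -> R) :
  (forall z, 0 <= a1 z <= 1) -> (forall z, 0 <= a2 z <= 1) ->
  forall z, 0 <= merge_thr s1 s2 a1 a2 z <= 1.
Proof.
move=> h1 h2 z; rewrite /merge_thr le_min ge_min.
have /andP[a10 a11] := h1 z; have /andP[a20 a21] := h2 z.
by apply/andP; split; [apply/andP; split; case: ifP|apply/orP; left; case: ifP].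
Qed.

Lemma void_events_setI : setI_closed (void_events mu).
Proof.
move=> _ _ [A1 [s1 [a1 [mA1 f1 h1 ->]]]] [A2 [s2 [a2 [mA2 f2 h2 ->]]]].
exists (A1 `|` A2), (s1 ++ s2), (merge_thr s1 s2 a1 a2); split.
- exact: measurableU.
- apply: (@le_lt_trans _ _ (mu A1 + mu A2)%E); first exact: measureU2.
  by rewrite lte_add_pinfty.
- exact: merge_thr01.
- by apply: void_eventI => z; [case/andP: (h1 z)|case/andP: (h2 z)].
Qed.

Lemma measurable_void_event A s (a : int * int -> R) :
  measurable A -> (mu A < +oo)%E -> (forall z, 0 <= a z <= 1) ->
  measurable (void_event A s a : set cfgm).
Proof. by move=> *; apply: sub_sigma_algebra; exists A, s, a. Qed.

Lemma void_eventsT : void_events mu setT.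
Proof.
exists set0, [::], (fun=> 0); split=> //; first by rewrite measure0.
  by move=> z; rewrite lexx ler01.
by apply/seteqP; split => // c _; split.
Qed.

(** Void events form a pi-system containing the whole space, so the whole space alone serves as the
    finite cover. *)
Lemma cfgm_measure_unique (m1 m2 : {measure set cfgm -> \bar R}) :
  (m1 setT < +oo)%E -> (forall E, void_events mu E -> m1 E = m2 E) ->
  forall E, measurable E -> m1 E = m2 E.
Proof.
move=> m1T m12 E mE.
apply: (@g_sigma_algebra_measure_unique _ R cfgm (void_events mu) _ (fun=> setT) _ _ m1 m2) => //.
- exact: sub_sigma_algebra.
- by move=> _; exact: void_eventsT.
- by apply/seteqP; split => // x _; exists 0%N.
- exact: void_events_setI.
Qed.

Lemma measurable_crestr B D : measurable B ->
  measurable_fun [set: cfgm] (crestr B D : cfgm -> cfgm).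
Proof.
move=> mB.
apply: (@measurability _ _ _ _ setT (crestr B D : cfgm -> cfgm) (void_events mu)) => //.
move=> _ [_ [A [s [a [mA f h ->]]]] <-]; rewrite setTI.
rewrite crestr_void; last by move=> z; case/andP: (h z).
apply: measurable_void_event => //; first exact: measurableI.
by apply: le_lt_trans f; apply: le_measure; rewrite ?inE//; exact: measurableI.
Qed.

Hypothesis mu_shift : forall s x0 A, measurable A -> mu (wshift s x0 @^-1` A) = mu A.

Lemma measurable_cshift z0 :
  measurable_fun [set: cfgm] (cshift z0 : cfgm -> cfgm).
Proof.
apply: (@measurability _ _ _ _ setT (cshift z0 : cfgm -> cfgm) (void_events mu)) => //.
move=> _ [_ [A [s [a [mA f h ->]]]] <-]; rewrite setTI cshift_void.
apply: measurable_void_event => //; last by rewrite mu_shift.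
by rewrite -[X in measurable X]setTI; apply: measurable_wshift.
Qed.

Context (Q : {measure set cfgm -> \bar R}).
Hypothesis QE : forall A s a, measurable A -> (mu A < +oo)%E ->
  (forall z, 0 <= a z <= 1) ->
  Q (void_event A s a) = (expR (- fine (mu A)) * \prod_(z <- undup s) a z)%:E.

Let QT : Q setT = 1%E.
Proof.
have := @QE set0 [::] (fun=> 0) measurable0.
rewrite measure0 /= oppr0 expR0 big_nil mulr1 => <- //.
  by congr (Q _); apply/seteqP; split => // c _; split.
by move=> z; rewrite lexx ler01.
Qed.

(** A void probability involves only [mu A] and a product over sites: the first is shift invariant,
    the second is merely reindexed. *)
Lemma cshift_law z0 (H : set cfgm) : measurable H -> Q (cshift z0 @^-1` H) = Q H.
Proof.
move=> mH; have ms := measurable_cshift z0.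
change (pushforward Q (cshift z0 : cfgm -> cfgm) H = Q H); apply/esym.
apply: (@cfgm_measure_unique Q (pushforward Q (cshift z0 : cfgm -> cfgm))) => //.
  by rewrite QT ltry.
move=> _ [A [s [a [mA f h ->]]]].
change (Q (void_event A s a) = Q (cshift z0 @^-1` void_event A s a)).
have mA' : measurable (wshift (- z0.2) (- z0.1) @^-1` A).
  by rewrite -[X in measurable X]setTI; apply: measurable_wshift.
rewrite cshift_void !QE ?mu_shift//; congr (_ * _)%:E.
rewrite undup_map_inj; last first.
  by move=> [x n] [x' n'] /= [] /addIr -> /addIr ->.
rewrite big_map; apply: eq_bigr => z _.
by rewrite /= !addrK -surjective_pairing.
Qed.

(** Intensities of disjoint sets of walks add in the exponent, and disjoint sets of sites split the
    product of thresholds. *)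
Lemma void_event_indep B D A1 A2 s1 s2 (a1 a2 : int * int -> R) :
  measurable B -> measurable A1 -> measurable A2 ->
  (mu A1 < +oo)%E -> (mu A2 < +oo)%E ->
  (forall z, 0 <= a1 z <= 1) -> (forall z, 0 <= a2 z <= 1) ->
  (Q (crestr B D @^-1` void_event A1 s1 a1 `&` crestr (~` B) (~` D) @^-1` void_event A2 s2 a2)
  = Q (crestr B D @^-1` void_event A1 s1 a1) *
    Q (crestr (~` B) (~` D) @^-1` void_event A2 s2 a2))%E.
Proof.
move=> mB mA1 mA2 f1 f2 h1 h2.
have mB' := measurableC mB.
have f1' : (mu (A1 `&` B) < +oo)%E.
  by apply: le_lt_trans f1; apply: le_measure; rewrite ?inE//; exact: measurableI.
have f2' : (mu (A2 `&` ~` B) < +oo)%E.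
  by apply: le_lt_trans f2; apply: le_measure; rewrite ?inE//; exact: measurableI.
have m1 := measurableI _ _ mA1 mB; have m2 := measurableI _ _ mA2 mB'.
have muU : mu (A1 `&` B `|` A2 `&` ~` B) = (mu (A1 `&` B) + mu (A2 `&` ~` B))%E.
  by apply: measureU => //; rewrite setIACA setICr setI0.
rewrite !crestr_void; try by move=> z; case/andP: (h1 z); case/andP: (h2 z).
rewrite void_eventI; try by move=> z; case/andP: (h1 z); case/andP: (h2 z).
rewrite !QE//; last 3 first.
- exact: measurableU.
- by rewrite muU lte_add_pinfty.
- exact: merge_thr01.
rewrite -EFinM muU fineD ?ge0_fin_numE// opprD expRD.
set t1 := [seq _ <- s1 | _]; set t2 := [seq _ <- s2 | _].
(* Sites of [t1] lie in [D] and sites of [t2] outside it, so the two lists share none. *)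
rewrite undup_cat big_cat /= (_ : [seq x <- undup t1 | x \notin t2] = undup t1); last first.
  apply/all_filterP/allP => z; rewrite mem_undup mem_filter => /andP[/asboolP Dz _].
  by rewrite mem_filter; apply/negP => /andP[/asboolP].
rewrite mulrACA; congr (_ * _ * (_ * _))%:E.
  apply: eq_big_seq => z; rewrite mem_undup /merge_thr => zt; rewrite zt.
  rewrite ifF; first by apply/min_idPl; case/andP: (h1 z).
  move: zt; rewrite mem_filter => /andP[/asboolP Dz _].
  by rewrite mem_filter; apply/negP => /andP[/asboolP].
apply: eq_big_seq => z; rewrite mem_undup /merge_thr => zt; rewrite zt.
rewrite ifF; first by apply/min_idPr; case/andP: (h2 z).
move: zt; rewrite mem_filter => /andP[/asboolP Dz _].
by rewrite mem_filter; apply/negP => /andP[/asboolP].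
Qed.

(** With [E] fixed, both sides are finite measures in [F], so agreement on void events is enough.
    Used once for each factor of the independence claim. *)
Lemma prod_measure_unique (f : cfgm -> cfgm) (E : set cfgm) (mf : measurable_fun setT f) :
  measurable E ->
  (forall F, void_events mu F -> Q (f @^-1` F `&` E) = (Q (f @^-1` F) * Q E)%E) ->
  forall F, measurable F -> Q (f @^-1` F `&` E) = (Q (f @^-1` F) * Q E)%E.
Proof.
move=> mE h F mF.
have QEfin : Q E \is a fin_num.
  rewrite ge0_fin_numE//; apply: (@le_lt_trans _ _ (Q setT)); last by rewrite QT ltry.
  by apply: le_measure; rewrite ?inE.
have r0 : 0 <= fine (Q E) by rewrite fine_ge0.
pose m1 := pushforward (mrestr Q mE) f.
pose m2 := pushforward (mscale (NngNum r0) Q) f.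
have e : m1 F = m2 F.
  apply: (@cfgm_measure_unique m1 m2) => //.
    change (Q (f @^-1` setT `&` E) < +oo)%E.
    by rewrite preimage_setT setTI ltey_eq QEfin.
  move=> G vG; change (Q (f @^-1` G `&` E) = ((fine (Q E))%:E * Q (f @^-1` G))%E).
  by rewrite h// fineK// muleC.
change (m1 F = (Q (f @^-1` F) * Q E)%E); rewrite e.
change (((fine (Q E))%:E * Q (f @^-1` F))%E = (Q (f @^-1` F) * Q E)%E).
by rewrite fineK// muleC.
Qed.

Lemma crestr_indep B D (H K : set cfgm) :
  measurable B -> measurable H -> measurable K ->
  Q (crestr B D @^-1` H `&` crestr (~` B) (~` D) @^-1` K) =
  (Q (crestr B D @^-1` H) * Q (crestr (~` B) (~` D) @^-1` K))%E.
Proof.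
move=> mB mH mK; have mB' := measurableC mB.
have mp B0 D0 (E : set cfgm) : measurable B0 -> measurable E ->
    measurable (crestr B0 D0 @^-1` E : set cfgm).
  by move=> mB0 mE; rewrite -[X in measurable X]setTI; apply: measurable_crestr.
have mc B0 D0 := @measurable_crestr B0 D0.
apply: (@prod_measure_unique (crestr B D) (crestr (~` B) (~` D) @^-1` K) (mc B D mB)) => //; first exact: mp.
move=> _ [A1 [s1 [a1 [mA1 f1 h1 ->]]]].
(* The first event is now a void event; swapping the factors lets the same extension treat the
   second. *)
rewrite setIC muleC.
apply: (@prod_measure_unique (crestr (~` B) (~` D)) (crestr B D @^-1` _) (mc (~` B) (~` D) mB')) => //.
  by apply: mp => //; exact: measurable_void_event.
move=> _ [A2 [s2 [a2 [mA2 f2 h2 ->]]]].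
by rewrite setIC muleC; exact: void_event_indep.
Qed.

End canonical_law.

Lemma measurable_cfg {R : realType} (mu : {measure set Wm -> \bar R})
    {d : measure_display} {Om : measurableType d}
    (om : Om -> Wm -> nat) (U : Om -> int * int -> R) :
  (forall A : set Wm, measurable A ->
     measurable_fun [set: Om] (fun t => cnt (R := R) (om t) A)) ->
  (forall y, measurable_fun [set: Om] (fun t => U t y)) ->
  measurable_fun [set: Om] (fun t => (om t, U t) : cfgm mu).
Proof.
move=> mom mU.
apply: (@measurability _ _ _ _ setT (fun t => (om t, U t) : cfgm mu) (void_events mu)) => //.
move=> _ [_ [A [s [a [mA f h ->]]]] <-]; rewrite setTI.
rewrite (_ : _ @^-1` _ =
    [set t | cnt (R := R) (om t) A = 0%E /\ forall z, z \in s -> U t z <= a z]); last first.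
  by apply/seteqP; split => t /= [h1 h2]; split => //; apply/(@cnt0P R).
apply: measurable_and.
  rewrite (_ : [set t | _] = setT `&` (fun t => cnt (R := R) (om t) A) @^-1` [set 0%E]).
    exact: mom.
  by rewrite setTI.
apply: measurable_forall => z; apply: measurable_imp => _.
rewrite (_ : [set t | _] = setT `&` (fun t => U t z) @^-1` `]-oo, a z]).
  exact: mU.
by rewrite setTI; apply/seteqP; split => t /=; rewrite in_itv.
Qed.

(** * Cones and the path recursion *)

Section paths.
Context {R : realType} (vbar pb po : R).
Implicit Types (c : cfg R) (y z : int * int).

Lemma in_cone_trans x y z : in_cone vbar x y -> in_cone vbar y z -> in_cone vbar x z.
Proof.
move=> [h1 [h2 h3]] [h4 [h5 h6]]; split; [lia|split; [lia|]].
move: h3 h6; rewrite !rmorphB /= => h3 h6; lra.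
Qed.

Lemma in_rcone_cone x y z : in_cone vbar x y -> in_rcone vbar x z -> in_rcone vbar y z.
Proof.
move=> [h1 [h2 h3]] [h4 [h5 h6]]; split; [lia|split; [lia|]].
move: h3 h6; rewrite !rmorphB /= => h3 h6; lra.
Qed.

Lemma in_cone_rconeF y z : in_cone vbar y z -> in_rcone vbar y z -> False.
Proof. by move=> [_ [_ h]] [_ [_]]; rewrite ltNge h. Qed.

Local Notation yp c y i := (Ypath pb po (trace c.1) c.2 y i).

Lemma YpathS Tr (U : _ -> R) y i :
  Ypath pb po Tr U y i.+1 = step pb po Tr U (Ypath pb po Tr U y i).
Proof. by []. Qed.

Lemma Ypath_add Tr (U : _ -> R) y i j :
  Ypath pb po Tr U y (j + i) = Ypath pb po Tr U (Ypath pb po Tr U y i) j.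
Proof. by rewrite /Ypath iterD. Qed.

Lemma step_eq Tr Tr' (U U' : _ -> R) z : (Tr z <-> Tr' z) -> U z = U' z ->
  step pb po Tr U z = step pb po Tr' U' z.
Proof. by move=> /propext e1 e2; rewrite /step e1 e2. Qed.

Lemma Ypath_time Tr (U : _ -> R) y i : (Ypath pb po Tr U y i).2 = y.2 + i%:Z.
Proof.
elim: i => [|i IH]; first by rewrite addr0.
by rewrite YpathS /step; case: ifP => _ /=; rewrite IH; lia.
Qed.

(** Locality of the path: it carries over to a restricted environment once the sites it visits are
    known to lie in the region kept. *)
Lemma Ypath_eq Tr Tr' (U U' : _ -> R) y n :
  (forall i, (i < n)%N -> (Tr (Ypath pb po Tr U y i) <-> Tr' (Ypath pb po Tr U y i)) /\
     U (Ypath pb po Tr U y i) = U' (Ypath pb po Tr U y i)) ->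
  forall i, (i <= n)%N -> Ypath pb po Tr' U' y i = Ypath pb po Tr U y i.
Proof.
move=> h; elim=> [//|i IH] ilt; rewrite !YpathS IH; last exact: ltnW.
by have [h1 h2] := h i ilt; apply/esym/step_eq.
Qed.

(** * Splitting the environment at a cone *)

Definition hitcone y : set Wm := [set w | exists n : int, in_cone vbar y (w n, n)].

Lemma measurable_hitcone y : measurable (hitcone y).
Proof.
apply: measurable_exists => n.
exact: (measurable_coord_pred n (fun x => in_cone vbar y (x, n))).
Qed.

(** Walks are sorted by whether they ever meet the cone, not cut at its boundary; [cin] and [cout]
    therefore use disjoint sets of walks and are independent. *)
Definition cin y : cfg R -> cfg R := crestr (hitcone y) (in_cone vbar y).
Definition cout y : cfg R -> cfg R := crestr (~` hitcone y) (~` in_cone vbar y).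

Lemma trace_cin c y z : in_cone vbar y z -> (trace c.1 z <-> trace (cin y c).1 z).
Proof.
move=> yz; split => -[w [w0 wz]]; exists w; split => //; move: w0 => /=.
  by case: asboolP => // nh; case: nh; exists z.2; rewrite wz -surjective_pairing.
by case: asboolP.
Qed.

Lemma U_cin c y z : in_cone vbar y z -> c.2 z = (cin y c).2 z.
Proof. by move=> yz /=; case: asboolP. Qed.

Lemma Ypath_cin c y : (forall i, in_cone vbar y (yp c y i)) ->
  forall i, yp (cin y c) y i = yp c y i.
Proof.
move=> h i; apply: (@Ypath_eq _ _ _ _ _ i) => // j _.
by split; [exact: trace_cin|exact: U_cin].
Qed.

(** The locality argument run from the restricted side, so that goodness can be recovered from
    [cin y c] alone. *)
Lemma Ypath_cinV c y : (forall i, in_cone vbar y (yp (cin y c) y i)) ->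
  forall i, yp (cin y c) y i = yp c y i.
Proof.
move=> h i; apply/esym/(@Ypath_eq _ _ _ _ _ i) => // j _.
by split; [apply: iff_sym; exact: trace_cin|exact/esym/U_cin].
Qed.

Lemma cross_cin c y :
  cnt (R := R) c.1 (Wcross vbar y) = 0%E <-> cnt (R := R) (cin y c).1 (Wcross vbar y) = 0%E.
Proof.
split => /(@cnt0P R) h; apply/(@cnt0P R) => w Bw; have := h w Bw => /= wE.
  by case: asboolP.
by case: asboolP wE => // nh; case: nh; case: Bw.
Qed.

Lemma good_cin c y : good vbar pb po c.1 c.2 y <-> good vbar pb po (cin y c).1 (cin y c).2 y.
Proof.
split => -[h1 h2]; split=> [|i]; try exact/(cross_cin c y).
  by rewrite Ypath_cin.
by rewrite -Ypath_cinV.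
Qed.

Lemma good_Ypath_cin c y : good vbar pb po c.1 c.2 y ->
  forall i, yp (cin y c) y i = yp c y i.
Proof. by move=> [_ h]; exact: Ypath_cin. Qed.

(** A walk of the configuration passing through [z] and meeting the cone would be a crossing walk,
    and there is none; so [cout] deletes no walk through [z]. *)
Lemma trace_cout c y z : cnt (R := R) c.1 (Wcross vbar y) = 0%E -> in_rcone vbar y z ->
  (trace c.1 z <-> trace (cout y c).1 z).
Proof.
move=> /(@cnt0P R) h yz; split => -[w [w0 wz]]; exists w; split => //; move: w0 => /=.
  case: asboolP => // nh; rewrite h//; split; first exact: contrapT.
  by exists z.2; rewrite wz -surjective_pairing.
by case: asboolP.
Qed.

Lemma U_cout c y z : in_rcone vbar y z -> c.2 z = (cout y c).2 z.
Proof. by move=> yz /=; case: asboolP => // nh; case: nh => /in_cone_rconeF; exact. Qed.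

(** * The past read outside the cone *)

Implicit Types (ys : nat -> int * int).

Definition follows c ys n : Prop := forall i, (i <= n)%N -> yp c (0, 0) i = ys i.

Lemma follows_time {c ys n m} : follows c ys n -> (m <= n)%N -> (ys m).2 = m%:Z.
Proof. by move=> f mn; rewrite -f// Ypath_time add0r. Qed.

(** Before a record time the path is strictly below the moving record level, which gives the slope
    inequality. Since [vbar] is positive and earlier times are smaller, the spatial inequality
    follows from it. *)
Lemma record_rcone {c ys n k m} : 0 < vbar -> follows c ys n ->
  isR vbar (fun i => (ys i).1) k n -> (m < n)%N -> in_rcone vbar (ys n) (ys m).
Proof.
move=> v0 f [r1 r2] mn; have := r2 m mn => {}r2.
have lt : ((ys m).1 - (ys n).1)%:~R < vbar * ((ys m).2 - (ys n).2)%:~R.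
  rewrite !(follows_time f) ?(ltnW mn)// !rmorphB /= -!pmulrn; lra.
split; last split => //.
- rewrite -(ler_int R) -subr_le0 -rmorphB; apply/ltW/(lt_le_trans lt).
  rewrite pmulr_rle0// lerz0 !(follows_time f) ?(ltnW mn)//; lia.
- by rewrite !(follows_time f) ?(ltnW mn)//; lia.
Qed.

(** Before time [n] the path is in the reverse cone of [ys n], where dropping the walks that meet
    the cone changes neither the trace nor the uniforms. *)
Lemma follows_cout {c ys n k} : 0 < vbar -> isR vbar (fun i => (ys i).1) k n ->
  cnt (R := R) c.1 (Wcross vbar (ys n)) = 0%E ->
  follows c ys n <-> follows (cout (ys n) c) ys n.
Proof.
move=> v0 r g; split => f i iln.
  rewrite -(f i)//; apply: (@Ypath_eq _ _ _ _ _ n) => // j jn.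
  have jr : in_rcone vbar (ys n) (yp c (0, 0) j).
    by rewrite (f _ (ltnW jn)); exact: (record_rcone v0 f r jn).
  by split; [exact: trace_cout|exact: U_cout].
rewrite -(f i)//; apply: (@Ypath_eq _ _ _ _ _ n) => // j jn.
have jr : in_rcone vbar (ys n) (yp (cout (ys n) c) (0, 0) j).
  by rewrite (f _ (ltnW jn)); exact: (record_rcone v0 f r jn).
by split; [apply: iff_sym; exact: trace_cout|exact/esym/U_cout].
Qed.

(* When the path follows ys and ys n is good, this is goodness of ys m, rewritten so as
   to make sense for the environment restricted outside the cone of ys n. *)
Definition good_upto c ys n m : Prop :=
  cnt (R := R) c.1 (Wcross vbar (ys m)) = 0%E /\
  forall i, (m <= i <= n)%N -> in_cone vbar (ys m) (ys i).

Lemma good_cout {c ys n m} : follows c ys n -> good vbar pb po c.1 c.2 (ys n) ->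
  (m <= n)%N ->
  good vbar pb po c.1 c.2 (ys m) <-> good_upto (cout (ys n) c) ys n m.
Proof.
move=> f [/(@cnt0P R) gn1 gn2] mn.
have e j : yp c (ys m) j = yp c (0, 0) (j + m) by rewrite Ypath_add (f m).
split => -[/(@cnt0P R) h1 h2].
  split; first by apply/(@cnt0P R) => w /h1 /= ->; case: asboolP.
  move=> i /andP[mi iln]; have := h2 (i - m)%N.
  by rewrite e subnK// (f i).
have mnC : in_cone vbar (ys m) (ys n) by apply: h2; rewrite mn leqnn.
split.
  (* A walk deleted by [cout] that crosses at [ys m] meets the cone of [ys n] and, by inclusion of
     reverse cones, also its reverse cone; goodness of [ys n] excludes it. *)
  apply/(@cnt0P R) => w wm; have := h1 w wm => /=; case: asboolP => // nh _.
  apply: gn1; split; first exact: contrapT.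
  by case: wm => _ [l hl]; exists l; exact: in_rcone_cone hl.
(* Up to time [n] the path is given by [ys]; later it stays in the cone of [ys n], which lies in
   that of [ys m]. *)
move=> j; rewrite e; case: (leqP (j + m) n) => jn.
  by rewrite (f _ jn); apply: h2; rewrite leq_addl.
apply: in_cone_trans mnC _; rewrite -(subnK (ltnW jn)) Ypath_add (f n)//.
Qed.

(** Evaluated at [cout], this is what the regeneration at time [n] and the path up to [n] say beyond
    goodness of [ys n]. The bound [m <= n] confines it to the known piece of path. *)
Definition past ys n : set (cfg R) := [set c | follows c ys n /\
  exists k, (1 <= k)%N /\ isR vbar (fun i => (ys i).1) k n /\
    forall j m, (1 <= j < k)%N -> (m <= n)%N -> isR vbar (fun i => (ys i).1) j m ->
      ~ good_upto c ys n m].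

Lemma isR_eq {X X' : nat -> int} {k n} : (forall i, (i <= n)%N -> X i = X' i) ->
  isR vbar X k n -> isR vbar X' k n.
Proof.
move=> e [h1 h2]; split; first by rewrite -e.
by move=> m mn; rewrite -e; [exact: h2|exact: ltnW].
Qed.

Lemma isR_mono {X : nat -> int} {j k m n} : vbar <= 1 -> (j <= k)%N ->
  isR vbar X k n -> isR vbar X j m -> (m <= n)%N.
Proof.
move=> v1 jk [h1 _] [_ h2]; rewrite leqNgt; apply/negP => /h2.
rewrite ltNge => /negP; apply; apply: le_trans h1.
by rewrite lerD2r ler_wpM2l ?subr_ge0// ler_nat.
Qed.

Lemma tau_past c ys n : 0 < vbar -> vbar <= 1 ->
  (tau_is vbar pb po c.1 c.2 n /\ follows c ys n) <->
  (good vbar pb po c.1 c.2 (ys n) /\ past ys n (cout (ys n) c)).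
Proof.
move=> v0 v1.
have isRy m j : follows c ys n -> (m <= n)%N ->
    isR vbar (fun i => (yp c (0, 0) i).1) j m <-> isR vbar (fun i => (ys i).1) j m.
  by move=> f mn; split; apply: isR_eq => i im; rewrite (f i)// (leq_trans im).
split.
  move=> [[k [k1 [r [g nog]]]] f]; move: g; rewrite (f n)// => g.
  have r' := (isRy n k f (leqnn n)).1 r.
  split => //; split; first exact: (follows_cout v0 r' g.1).1.
  exists k; split => //; split => // j m jk mn rj /(good_cout f g mn).
  by have := nog j m jk ((isRy m j f mn).2 rj); rewrite (f m).
move=> [g [f [k [k1 [r nog]]]]].
have {}f : follows c ys n by exact: (follows_cout v0 r g.1).2.
split => //; exists k; split => //; split; first exact: (isRy n k f (leqnn n)).2.
rewrite (f n)//; split => // j m jk rj.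
(* Record times are monotone in the index, so a smaller index is never reached after [n]; this
   supplies the bound required by [past]. *)
have mn : (m <= n)%N.
  apply: isR_mono v1 _ ((isRy n k f (leqnn n)).2 r) rj.
  by case/andP: jk => _ /ltnW.
by rewrite (f m)// => /(good_cout f g mn); apply: nog jk mn ((isRy m j f mn).1 rj).
Qed.

(** Goodness is built in so that the event depends on the environment through [cin] alone, as
    [future_cin] shows. *)
Definition future ys y K : set (cfg R) := [set c | good vbar pb po c.1 c.2 y /\
  forall i, (i <= K)%N -> ((yp c y i).1 - y.1, (yp c y i).2 - y.2) = ys i].

Lemma future_cin ys y K c : future ys y K c <-> future ys y K (cin y c).
Proof.
split => -[g h]; split=> [|i iK]; try exact/(good_cin c y).
  by rewrite good_Ypath_cin// h.
by rewrite -good_Ypath_cin; [exact: h|exact/(good_cin c y)].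
Qed.

(** * Translating the environment to the origin *)

Lemma trace_cshift y z c : trace (cshift y c).1 z <-> trace c.1 (z.1 + y.1, z.2 + y.2).
Proof.
split=> -[w [w0 wz]].
  by exists (wshift y.2 y.1 w); split => //=; rewrite /wshift addrK wz.
exists (wshift (- y.2) (- y.1) w); split; first by rewrite /= wshiftVK.
by rewrite /wshift opprK /= wz addrK.
Qed.

Lemma Ypath_cshift y c i :
  yp c y i = ((yp (cshift y c) (0, 0) i).1 + y.1, (yp (cshift y c) (0, 0) i).2 + y.2).
Proof.
elim: i => [|i IH]; first by rewrite /= !add0r -surjective_pairing.
rewrite !YpathS /step.
set z := Ypath _ _ (trace (cshift y c).1) _ _ _ in IH *.
rewrite IH /= (propext (trace_cshift y z c)).
by case: ifP => _ /=; congr (_, _); rewrite addrAC.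
Qed.

Lemma in_cone_shift y z : in_cone vbar y (z.1 + y.1, z.2 + y.2) <-> in_cone vbar (0, 0) z.
Proof.
by rewrite /in_cone /= !addrK !subr0; split => -[h1 [h2 h3]]; split; try lia; split => //; lia.
Qed.

Lemma in_rcone_shift y z : in_rcone vbar y (z.1 + y.1, z.2 + y.2) <-> in_rcone vbar (0, 0) z.
Proof.
by rewrite /in_rcone /= !addrK !subr0; split => -[h1 [h2 h3]]; split; try lia; split => //; lia.
Qed.

Lemma Wcross_shift y w : Wcross vbar (0, 0) w <-> Wcross vbar y (wshift y.2 y.1 w).
Proof.
split => -[[n hn] [m hm]]; split.
- by exists (n + y.2); rewrite /wshift addrK; apply/(in_cone_shift y (w n, n)).
- by exists (m + y.2); rewrite /wshift addrK; apply/(in_rcone_shift y (w m, m)).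
- exists (n - y.2); apply/(in_cone_shift y (w (n - y.2), n - y.2)).
  by rewrite /= subrK.
- exists (m - y.2); apply/(in_rcone_shift y (w (m - y.2), m - y.2)).
  by rewrite /= subrK.
Qed.

Lemma good_cshift y c :
  good vbar pb po c.1 c.2 y <-> good vbar pb po (cshift y c).1 (cshift y c).2 (0, 0).
Proof.
split => -[/(@cnt0P R) h1 h2]; split.
- by apply/(@cnt0P R) => w /(Wcross_shift y) /h1.
- by move=> i; have := h2 i; rewrite Ypath_cshift => /in_cone_shift.
- apply/(@cnt0P R) => w; rewrite -{1 2}(wshiftVK y.2 y.1 w) => /(Wcross_shift y) /h1.
  by rewrite /=.
- by move=> i; rewrite Ypath_cshift; apply/in_cone_shift; exact: h2.
Qed.

Lemma future_cshift ys y K c : future ys y K c <-> future ys (0, 0) K (cshift y c).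
Proof.
split => -[g h]; split=> [|i iK]; try exact/(good_cshift y c).
  by have := h i iK; rewrite Ypath_cshift /= !addrK !subr0.
by rewrite Ypath_cshift /= !addrK; have := h i iK; rewrite /= !subr0.
Qed.

(** * Measurability of the path events *)

Section measurability_of_events.
Context (mu : {measure set Wm -> \bar R}).
Hypothesis mu_coord : forall n x, (mu [set w : Wm | w n = x] < +oo)%E.
Hypotheses (pb01 : 0 <= pb <= 1) (po01 : 0 <= po <= 1).
Local Notation cfgm := (cfgm mu).

Lemma measurable_void (A : set Wm) : measurable A -> (mu A < +oo)%E ->
  measurable [set c : cfgm | forall w, A w -> c.1 w = 0%N].
Proof.
move=> mA f; rewrite (_ : [set c | _] = void_event A [::] (fun=> 0)).
  by apply: measurable_void_event => // z; rewrite lexx ler01.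
by apply/seteqP; split => c => [h|[h _]] //; split.
Qed.

Lemma measurable_cU z a : 0 <= a <= 1 -> measurable [set c : cfgm | c.2 z <= a].
Proof.
move=> a01; rewrite (_ : [set c | _] = void_event set0 [:: z] (fun=> a)).
  by apply: measurable_void_event => //; rewrite measure0.
apply/seteqP; split => c /= => [h|[_ h]]; last by apply: h; rewrite inE.
by split => // z'; rewrite inE => /eqP ->.
Qed.

Lemma measurable_ctrace z : measurable [set c : cfgm | trace c.1 z].
Proof.
rewrite (_ : [set c | _] =
    [set c : cfgm | ~ forall w, [set w : Wm | w z.2 = z.1] w -> c.1 w = 0%N]).
  by apply: measurable_not; apply: measurable_void => //; exact: measurable_coord.
apply/seteqP; split => c /=.
  by move=> [w [w0 wz]] /(_ w wz) e; rewrite e in w0.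
move=> h; apply: contrapT => nt; apply: h => w wz; apply/eqP; rewrite -leqn0 leqNgt.
by apply/negP => w0; apply: nt; exists w.
Qed.

Lemma measurable_step z z' :
  measurable [set c : cfgm | step pb po (trace c.1) c.2 z = z'].
Proof.
pose S (c : cfgm) := (trace c.1 z /\ c.2 z <= pb) \/ (~ trace c.1 z /\ c.2 z <= po).
have mS : measurable [set c | S c].
  apply: measurable_or; apply: measurable_and.
  - exact: measurable_ctrace.
  - exact: measurable_cU.
  - by apply: measurable_not; exact: measurable_ctrace.
  - exact: measurable_cU.
rewrite (_ : [set c | _] = [set c | (S c /\ (z.1 + 1, z.2 + 1) = z') \/
    (~ S c /\ (z.1 - 1, z.2 + 1) = z')]).
  apply: measurable_or; apply: measurable_and => //; try exact: measurable_const.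
  exact: measurable_not.
apply/seteqP; split => c /=; rewrite /step -/(S c); case: asboolP => s.
- by left.
- by right.
- by case=> -[].
- by case=> -[].
Qed.

Lemma measurable_Ypath y i (Q : int * int -> Prop) :
  measurable [set c : cfgm | Q (yp c y i)].
Proof.
suff m z : measurable [set c : cfgm | yp c y i = z].
  rewrite (_ : [set c | _] = [set c | exists z, Q z /\ yp c y i = z]).
    by apply: measurable_exists => z; apply: measurable_and => //; exact: measurable_const.
  apply/seteqP; split => c /=; first by exists (yp c y i).
  by move=> [z [Qz ->]].
elim: i z => [|i IH] z; first exact: (@measurable_const _ cfgm (y = z)).
rewrite (_ : [set c | _] =
   [set c : cfgm | exists z', yp c y i = z' /\ step pb po (trace c.1) c.2 z' = z]).
  by apply: measurable_exists => z'; apply: measurable_and => //; exact: measurable_step.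
apply/seteqP; split => c /=; first by exists (yp c y i).
by move=> [z' [<-]].
Qed.

(** Void events ask for finite intensity, which is not established for [Wcross]. It is therefore
    split over pairs of sites, one in each cone: the walks through both have finite intensity, and
    there are countably many pairs. *)
Lemma measurable_cross y :
  measurable [set c : cfgm | cnt (R := R) c.1 (Wcross vbar y) = 0%E].
Proof.
pose W z z' : set Wm := [set w | w z.2 = z.1] `&` [set w | w z'.2 = z'.1].
have mW (z z' : int * int) : measurable (W z z').
  by apply: measurableI; exact: measurable_coord.
rewrite (_ : [set c | _] = [set c : cfgm | forall z, in_cone vbar y z -> forall z',
   in_rcone vbar y z' -> forall w, W z z' w -> c.1 w = 0%N]).
  apply: measurable_forall => z; apply: measurable_imp => _.
  apply: measurable_forall => z'; apply: measurable_imp => _.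
  apply: (measurable_void (W z z')); first exact: mW.
  apply: (@le_lt_trans _ _ (mu [set w : Wm | w z.2 = z.1])) => //.
  apply: le_measure; rewrite ?inE; [exact: mW|exact: measurable_coord|by move=> w []].
apply/seteqP; split => c /=.
  move=> /(@cnt0P R) h z zc z' zr w [wz wz']; apply: h; split.
    by exists z.2; rewrite wz -surjective_pairing.
  by exists z'.2; rewrite wz' -surjective_pairing.
move=> h; apply/(@cnt0P R) => w [[n hn] [m hm]].
exact: (h _ hn _ hm).
Qed.

Lemma measurable_future ys y K : measurable (future ys y K : set cfgm).
Proof.
apply: measurable_and; first apply: measurable_and.
- exact: measurable_cross.
- by apply: measurable_forall => i; exact: measurable_Ypath.
- apply: measurable_forall => i; apply: measurable_imp => _.
  exact: (measurable_Ypath y i (fun z => (z.1 - y.1, z.2 - y.2) = ys i)).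
Qed.

Lemma measurable_good_upto ys n m : measurable [set c : cfgm | good_upto c ys n m].
Proof.
by apply: measurable_and; [exact: measurable_cross|exact: measurable_const].
Qed.

Lemma measurable_past ys n : measurable (past ys n : set cfgm).
Proof.
apply: measurable_and.
  apply: measurable_forall => i; apply: measurable_imp => _.
  exact: (measurable_Ypath (0, 0) i (fun z => z = ys i)).
apply: measurable_exists => k; apply: measurable_and; first exact: measurable_const.
apply: measurable_and; first exact: measurable_const.
do 2![apply: measurable_forall => ?]; do 3![apply: measurable_imp => ?].
by apply: measurable_not; exact: measurable_good_upto.
Qed.

End measurability_of_events.
End paths.

(** * The renewal identity *)

Section renewal.
Context {R : realType} (q po pb rho vbar : R) (Px : int -> {measure set Wm -> \bar R})
  {d : measure_display} {Om : measurableType d} (P : probability Om R)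
  (om : Om -> Wm -> nat) (U : Om -> int * int -> R).
Hypotheses (po01 : 0 <= po <= 1) (pb01 : 0 <= pb <= 1) (rho0 : 0 < rho).
Hypothesis Pxlaw : lazy_walk_laws q Px.
Hypothesis mom : forall A : set Wm, measurable A ->
  measurable_fun [set: Om] (fun t => cnt (R := R) (om t) A).
Hypothesis mU : forall y, measurable_fun [set: Om] (fun t => U t y).
Hypothesis ppp : ppp_unif_law P om U (intensity rho Px).

Let mu := intensity_measure rho Px rho0.
Let X (t : Om) : cfgm mu := (om t, U t).
Let mX : measurable_fun setT X := measurable_cfg mu om U mom mU.
Local Notation future := (@future R vbar pb po).

Let mu_coord n x : (mu [set w : Wm | w n = x] < +oo)%E.
Proof. by rewrite (intensity_coord q rho Px rho0 Pxlaw) ltry. Qed.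

Let mXpre (E : set (cfgm mu)) : measurable E -> measurable (X @^-1` E).
Proof. by move=> mE; rewrite -[X in measurable X]setTI; exact: mX. Qed.

(** [future] sees only [cin] and the other event only [cout], so the probability factors;
    stationarity of the law then moves [y] to the origin. *)
Lemma renewal (E : set (cfgm mu)) y zs K : measurable E ->
  P (X @^-1` (future zs y K `&` cout vbar y @^-1` E)) =
  (P (X @^-1` future zs (0, 0)%R K) * P (X @^-1` (cout vbar y @^-1` E)))%E.
Proof.
move=> mE.
pose Q : {measure set (cfgm mu) -> \bar R} := distribution P (mfun_Sub (mem_set mX)).
have QE (A : set Wm) s (a : int * int -> R) : measurable A -> (mu A < +oo)%E ->
    (forall z, 0 <= a z <= 1) ->
    Q (void_event A s a) = (expR (- fine (mu A)) * \prod_(z <- undup s) a z)%:E.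
  by move=> mA f a01; rewrite -(ppp_void P om U _ A s a ppp).
have mF := measurable_future vbar pb po mu mu_coord pb01 po01 zs.
have mB := measurable_hitcone vbar y.
have shift := intensity_shift q rho Px rho0 Pxlaw.
rewrite (_ : _ `&` _ = cin vbar y @^-1` future zs y K `&` cout vbar y @^-1` E); last first.
  apply/seteqP; split => c [h Ec]; split => //.
    exact: (future_cin vbar pb po zs y K c).1 h.
  exact: (future_cin vbar pb po zs y K c).2 h.
change (Q (cin vbar y @^-1` future zs y K `&` cout vbar y @^-1` E) =
  Q (future zs (0, 0)%R K) * Q (cout vbar y @^-1` E))%E.
rewrite (crestr_indep mu Q QE)//; congr (_ * _)%E.
rewrite -[RHS](cshift_law mu shift Q QE y)//; congr (Q _).
apply/seteqP; split => c.
  move=> h; apply: (future_cshift vbar pb po zs y K c).1.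
  exact: (future_cin vbar pb po zs y K c).2 h.
move=> h; apply: (future_cin vbar pb po zs y K c).1.
exact: (future_cshift vbar pb po zs y K c).2 h.
Qed.

(** Makes goodness an instance of [future], so that [renewal] treats both numerator and denominator
    of a conditional probability. *)
Lemma future0 y : future (fun=> (0, 0)) y 0 = [set c | good vbar pb po c.1 c.2 y].
Proof.
apply/seteqP; split => c; first by case.
by move=> g; split => // i; rewrite leqn0 => /eqP ->; rewrite /= !subrr.
Qed.

Lemma condP_renewal (E : set (cfgm mu)) (A F : set Om) y zs K : measurable E ->
  A = X @^-1` ([set c | good vbar pb po c.1 c.2 y] `&` cout vbar y @^-1` E) ->
  F `&` A = X @^-1` (future zs y K `&` cout vbar y @^-1` E) ->
  0 < fine (P A) ->
  condP P A F = fine (P (X @^-1` future zs (0, 0) K)) /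
                fine (P (X @^-1` [set c | good vbar pb po c.1 c.2 (0, 0)])).
Proof.
move=> mE AE FE; rewrite /condP FE AE -!future0 !renewal//.
have mF ws y' K' := measurable_future vbar pb po mu mu_coord pb01 po01 ws y' K'.
have mC : measurable (cout vbar y @^-1` E : set (cfgm mu)).
  rewrite -[X in measurable X]setTI; apply: measurable_crestr => //.
  by apply: measurableC; exact: measurable_hitcone.
have fin (B : set (cfgm mu)) : measurable B -> P (X @^-1` B) \is a fin_num.
  by move=> mB; apply: fin_num_measure; exact: mXpre.
rewrite !fineM ?fin// => pos.
(* Positivity of [P A] forces the factor of the outside event to be nonzero, and it cancels. *)
by rewrite -mulf_div divff ?mulr1//; apply: contraTneq pos => ->; rewrite mulr0 ltxx.
Qed.

End renewal.

(** The pair of [tau] and the path up to [tau] takes countably many values on [tau] finite, so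
    conditioning is elementary on each atom of positive probability. Laws of paths are compared
    through their finite-dimensional distributions up to each [K]. *)
Theorem theorem4p1 (R : realType) (q po pb rho vstar c0 gam : R)
    (Px : int -> {measure set Wm -> \bar R})
    (d : measure_display) (Om : measurableType d) (P : probability Om R)
    (om : Om -> Wm -> nat) (U : Om -> int * int -> R) :
  0 < q < 1 -> 0 <= po <= 1 -> 0 <= pb <= 1 ->
  0 < 2 * pb - 1 -> -1 < 2 * po - 1 -> 0 < rho ->
  lazy_walk_laws q Px ->
  (forall A : set Wm, measurable A ->
     measurable_fun [set: Om] (fun t => cnt (R := R) (om t) A)) ->
  (forall y, measurable_fun [set: Om] (fun t => U t y)) ->
  ppp_unif_law P om U (intensity rho Px) ->
  0 < vstar < 2 * pb - 1 -> 0 < c0 -> 1 < gam ->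
  (forall L : nat, (1 <= L)%N ->
     fine (P [set t | exists n : nat,
        ((Ypath pb po (trace (om t)) (U t) (0, 0) n).1)%:~R < n%:R * vstar - L%:R])
     <= c0^-1 * expR (- (c0 * (ln (L%:R : R)) `^ gam))) ->
  let vbar := vstar / 3 in
  let Y := fun t => Ypath pb po (trace (om t)) (U t) (0, 0) in
  let Cang := [set t | good vbar pb po (om t) (U t) (0, 0)] in
  let Pang := fun E => condP P Cang E in
  forall (n : nat) (ys : nat -> int * int),
  let Atom := [set t | tau_is vbar pb po (om t) (U t) n /\
                       forall i, (i <= n)%N -> Y t i = ys i] in
  (0 < fine (P Atom) ->
     forall (K : nat) (zs : nat -> int * int),
       condP P Atom [set t | forall i, (i <= K)%N ->
                      ((Y t (n + i)).1 - (Y t n).1, (Y t (n + i)).2 - (Y t n).2) = zs i]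
       = Pang [set t | forall i, (i <= K)%N -> Y t i = zs i]) /\
  (0 < Pang Atom ->
     forall (K : nat) (zs : nat -> int * int),
       condP P (Atom `&` Cang) [set t | forall i, (i <= K)%N ->
                      ((Y t (n + i)).1 - (Y t n).1, (Y t (n + i)).2 - (Y t n).2) = zs i]
       = Pang [set t | forall i, (i <= K)%N -> Y t i = zs i]).
Proof.
move=> _ po01 pb01 _ _ rho0 Pxlaw mom mU ppp /andP[vs0 vs1] _ _ _ vbar Y Cang Pang n ys Atom.
have vbar0 : 0 < vbar by rewrite /vbar; lra.
have vbar1 : vbar <= 1 by move/andP: pb01 => []; rewrite /vbar; lra.
pose mu := intensity_measure rho Px rho0.
pose X (t : Om) : cfgm mu := (om t, U t).
have mu_coord m x : (mu [set w : Wm | w m = x] < +oo)%E.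
  by rewrite (intensity_coord q rho Px rho0 Pxlaw) ltry.
pose yn := ys n.
pose F K zs := [set t | forall i, (i <= K)%N ->
  ((Y t (n + i)).1 - (Y t n).1, (Y t (n + i)).2 - (Y t n).2) = zs i].
have AtomE : Atom = X @^-1` ([set c | good vbar pb po c.1 c.2 yn] `&`
    cout vbar yn @^-1` past vbar pb po ys n).
  apply/seteqP; split => t.
    exact: (tau_past vbar pb po (X t) ys n vbar0 vbar1).1.
  exact: (tau_past vbar pb po (X t) ys n vbar0 vbar1).2.
have PangE K zs : Pang [set t | forall i, (i <= K)%N -> Y t i = zs i] =
    fine (P (X @^-1` future vbar pb po zs (0, 0) K)) /
    fine (P (X @^-1` [set c | good vbar pb po c.1 c.2 (0, 0)])).
  rewrite /Pang /condP; congr (fine (P _) / _).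
  apply/seteqP; split => t [h1 h2]; split => //= i iK.
    by rewrite !subr0 -surjective_pairing; exact: h1.
  by have := h2 i iK; rewrite !subr0 -surjective_pairing.
have addE i : n + i = (i + n)%N by exact: addnC.
have FE (E : set (cfg R)) K zs : E `<=` past vbar pb po ys n ->
    F K zs `&` (X @^-1` ([set c | good vbar pb po c.1 c.2 yn] `&` cout vbar yn @^-1` E)) =
    X @^-1` (future vbar pb po zs yn K `&` cout vbar yn @^-1` E).
  move=> Epast; apply/seteqP; split => t.
    move=> [h [g Et]]; split => //; split => // i iK.
    have [_ f] := (tau_past vbar pb po (X t) ys n vbar0 vbar1).2 (conj g (Epast _ Et)).
    by have := h i iK; rewrite addE /Y Ypath_add (f n).
  move=> [[g h] Et]; split => // i iK.
  have [_ f] := (tau_past vbar pb po (X t) ys n vbar0 vbar1).2 (conj g (Epast _ Et)).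
  by have := h i iK; rewrite addE /Y Ypath_add (f n).
have mpast : measurable (past vbar pb po ys n : set (cfgm mu)).
  exact: measurable_past.
split => [Apos K zs|Apos K zs].
  rewrite PangE.
  apply: (condP_renewal q po pb rho vbar Px P om U po01 pb01 rho0 Pxlaw mom mU ppp
    (past vbar pb po ys n) Atom _ yn zs K) => //.
  by rewrite {1}AtomE; exact: FE.
(* Under [Pang] the origin is good as well. As [ys 0] is the origin on the atom, [good_cout] with
   [m = 0] turns this into one more event of [cout]. *)
pose E := past vbar pb po ys n `&` [set c | good_upto vbar c ys n 0].
have AE : Atom `&` Cang = X @^-1` ([set c | good vbar pb po c.1 c.2 yn] `&`
    cout vbar yn @^-1` E).
  apply/seteqP; split => t.
    move=> [At Ct]; have := At; rewrite {1}AtomE => -[g p]; split => //; split => //.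
    have f : follows pb po (X t) ys n := At.2.
    by apply: (good_cout vbar pb po f g (leq0n n)).1; rewrite -(f 0%N).
  move=> [g [p u]].
  have [tn f] := (tau_past vbar pb po (X t) ys n vbar0 vbar1).2 (conj g p).
  split; first by [].
  by have := (good_cout vbar pb po f g (leq0n n)).2 u; rewrite -(f 0%N).
rewrite PangE.
apply: (condP_renewal q po pb rho vbar Px P om U po01 pb01 rho0 Pxlaw mom mU ppp
    E (Atom `&` Cang) _ yn zs K) => //.
- apply: measurableI => //; exact: measurable_good_upto.
- by rewrite {1}AE; apply: FE => c [].
- rewrite lt0r fine_ge0// andbT; apply: contraTneq Apos => e.
  by rewrite /Pang /condP e mul0r ltxx.
Qed.
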